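(* For every integer $n\ge 3$, $e(3,n)=\left\lceil \tfrac{3}{2}(n-1)\right\rceil$; that is, the minimum number of edges of a connected $3^*$-dense graph on $n$ vertices is $\left\lceil \tfrac{3}{2}(n-1)\right\rceil$.
   Context: All graphs are finite and simple. For an edge $uv$ of a graph $G$, the edge multiplicity is $m_G(uv)=|N_G(u)\cap N_G(v)|$. For an integer $k\ge 2$, a graph $G$ is called $k$-dense if $G$ has no isolated vertices and every edge $uv$ of $G$ satisfies $m_G(uv)\ge k-2$. A graph is $k^*$-dense if it is $k$-dense but not $(k+1)$-dense. For positive integers $k,n$, $e(k,n)$ denotes the minimum number of edges of a connected graph on $n$ vertices that is $k^*$-dense. *)

(* Defs.v *)
From HB Require Import structures.
From mathcomp Require Import all_boot all_order all_algebra.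

Set Implicit Arguments.
Unset Strict Implicit.
Unset Printing Implicit Defensive.

Record sgraph := SGraph {
  vertex :> finType;
  adj : rel vertex;
  adj_sym : symmetric adj;
  adj_irrefl : irreflexive adj }.

Definition neighbours (G : sgraph) (u : G) : {set G} := [set v | adj u v].

Definition edges (G : sgraph) : {set {set G}} :=
  [set [set u; v] | u in G, v in neighbours u].

Definition multiplicity (G : sgraph) (u v : G) : nat :=
  #|neighbours u :&: neighbours v|.

Definition connected (G : sgraph) : Prop :=
  0 < #|G| /\ forall u v : G, connect (@adj G) u v.

(* Meaningful for 2 <= k only: the subtraction k - 2 is truncated. *)
Definition dense (k : nat) (G : sgraph) : Prop :=
  (forall u : G, exists v : G, adj u v) /\
  (forall u v : G, adj u v -> k - 2 <= multiplicity u v).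

Definition star_dense (k : nat) (G : sgraph) : Prop :=
  dense k G /\ ~ dense k.+1 G.

(* [min_edges k n m] means "e(k, n) is defined and equal to m".  A relation is
   used because the minimum is undefined when no such graph exists. *)
Definition min_edges (k n m : nat) : Prop :=
  let admissible (G : sgraph) :=
    [/\ #|G| = n, connected G & star_dense k G] in
  (exists G : sgraph, admissible G /\ #|edges G| = m) /\
  (forall G : sgraph, admissible G -> m <= #|edges G|).

(* Main.v *)
Require Import Defs.
From mathcomp Require Import all_boot all_order all_algebra.
From mathcomp Require Import zify lra.

(** Lower bound: grow a vertex set [S] from a single vertex, keeping
    [2 * e(S) >= 3 * (#|S| - 1)].  An edge leaving [S] lies in a triangle, which
    adds to [S] either one vertex and at least two edges, or two vertices and at
    least three edges.  Upper bound: triangles sharing a hub (a friendship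
    graph); when the number of leaves is odd, the last leaf is also joined to
    its predecessor. *)

Definition induced_edges (G : sgraph) (S : {set G}) : {set {set G}} :=
  [set e in edges G | e \subset S].

Lemma adj_neq (G : sgraph) (u v : G) : adj u v -> u != v.
Proof. by apply: contraTneq => ->; rewrite adj_irrefl. Qed.

Lemma mem_edges (G : sgraph) (u v : G) : adj u v -> [set u; v] \in edges G.
Proof. by move=> uv; apply/imset2P; exists u v; rewrite ?inE. Qed.

Lemma pair_neq (T : finType) (a b c : T) :
  a != b -> a != c -> [set a; b] != [set b; c].
Proof.
move=> ab ac; apply/eqP => /setP/(_ a).
by rewrite !inE eqxx (negPf ab) (negPf ac).
Qed.

(** No member of [D] lies inside [S], so [D] is disjoint from the edges induced on [S], and both
    families sit among those induced on [T]. *)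
Lemma card_induced_edges_add (G : sgraph) (S T : {set G}) (D : {set {set G}}) :
  S \subset T -> D \subset induced_edges G T ->
  (forall e, e \in D -> ~~ (e \subset S)) ->
  #|induced_edges G S| + #|D| <= #|induced_edges G T|.
Proof.
move=> ST DT DS.
have disj : induced_edges G S :&: D = set0.
  apply/setP => e; rewrite !inE; apply/negP => /andP[/andP[_ eS] /DS].
  by rewrite eS.
(* Subtracting the size of the empty intersection turns the sum into the cardinal of a union. *)
rewrite -[X in X <= _]subn0 -[X in _ - X](@cards0 {set G}) -disj -cardsU.
apply/subset_leq_card; rewrite subUset DT andbT.
apply/subsetP => e; rewrite !inE => /andP[-> eS].
exact: subset_trans eS ST.
Qed.

(** If no edge left [S], then [S] would be closed under adjacency, hence a union of components,
    hence everything. *)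
Lemma boundary_edge (G : sgraph) (S : {set G}) (v0 : G) :
  connected G -> v0 \in S -> S != setT ->
  exists u v, [/\ u \in S, v \notin S & adj u v].
Proof.
move=> [_ conn] v0S SnT.
have [/existsP[u /existsP[v /and3P[]]]|none] :=
  boolP [exists u : G, exists v : G, [&& u \in S, v \notin S & adj u v]].
  by exists u, v.
case/negP: SnT; apply/eqP/setP => y; rewrite inE.
have step x z : adj x z -> x \in S -> z \in S.
  move=> xz xS; apply: contraNT none => zS.
  by apply/existsP; exists x; apply/existsP; exists z; rewrite xS zS.
have clS : closed (@adj G) (mem S).
  by move=> x z xz; apply/idP/idP; apply: step; rewrite // adj_sym.
by rewrite -[LHS](closed_connect clS (conn v0 y)).
Qed.

Lemma connected_dense3_edges (G : sgraph) :
  connected G -> dense 3 G -> 3 * (#|G| - 1) <= 2 * #|edges G|.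
Proof.
move=> conn [_ dens]; have [/card_gt0P[v0 _] _] := conn.
(* The invariant is written without truncated subtraction. A maximal good set replaces step-by-step
   growth. *)
pose good (S : {set G}) :=
  (v0 \in S) && (3 * #|S| <= 2 * #|induced_edges G S| + 3).
have [S /maxsetP[/andP[v0S cS] maxS] _] : {S | maxset good S & [set v0] \subset S}.
  by apply: maxset_exists; rewrite /good inE eqxx cards1; lia.
have [ST|SnT] := eqVneq S setT.
  have : #|induced_edges G S| <= #|edges G|.
    by apply/subset_leq_card/subsetP => e; rewrite inE => /andP[].
  by rewrite ST cardsT in cS *; lia.
have [u [v [uS vS uv]]] := boundary_edge G S v0 conn v0S SnT.
have /card_gt0P[w] : 0 < multiplicity u v by apply: dens.
rewrite !inE => /andP[uw vw].
have uNv := adj_neq _ _ _ uv; have uNw := adj_neq _ _ _ uw.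
have vNw := adj_neq _ _ _ vw.
have wu : adj w u by rewrite adj_sym.
have grow (T : {set G}) : S \subset T -> v \in T ->
    3 * #|T| <= 2 * #|induced_edges G T| + 3 -> False.
  move=> sST vT cT; case/negP: vS.
  by rewrite -(maxS T) // /good cT (subsetP sST).
exfalso; have [wS|wS] := boolP (w \in S).
(* The triangle closes inside [S]: one new vertex costs 3, two new edges pay 4. *)
- pose D := [set [set u; v]; [set v; w]].
  have cD : #|D| = 2 by rewrite cards2 pair_neq.
  have cT : #|v |: S| = #|S|.+1 by rewrite cardsU1 vS.
  apply: (grow (v |: S)); rewrite ?subsetUr ?setU11 //.
  suff : #|induced_edges G S| + #|D| <= #|induced_edges G (v |: S)| by lia.
  apply: card_induced_edges_add; first exact: subsetUr.
    apply/subsetP => e; rewrite !inE => /orP[]/eqP->;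
      by rewrite mem_edges //= subUset !sub1set !inE ?eqxx ?uS ?wS ?orbT.
  by move=> e; rewrite !inE => /orP[]/eqP->;
    rewrite subUset !sub1set (negPf vS) ?andbF.
(* The triangle meets [S] only in [u]: two new vertices cost 6, three new edges pay exactly 6. *)
pose D := [set [set u; v]; [set v; w]; [set w; u]].
have cD : #|D| = 3.
  rewrite /D setUC cardsU1 cards2 pair_neq // !inE negb_or.
  by rewrite [[set w; u] == [set v; w]]eq_sym !pair_neq // eq_sym.
have cT : #|w |: (v |: S)| = #|S|.+2.
  by rewrite !cardsU1 !inE (negPf vS) (negPf wS) eq_sym (negPf vNw).
have ST : S \subset w |: (v |: S).
  by apply/subsetP => x xS; rewrite !inE xS !orbT.
apply: (grow (w |: (v |: S))); rewrite ?ST //; first by rewrite !inE eqxx orbT.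
suff : #|induced_edges G S| + #|D| <= #|induced_edges G (w |: (v |: S))| by lia.
apply: card_induced_edges_add => //.
  apply/subsetP => e; rewrite !inE => /orP[/orP[]|]/eqP->;
    by rewrite mem_edges //= subUset !sub1set !inE ?eqxx ?uS ?orbT.
move=> e; rewrite !inE => /orP[/orP[]|]/eqP->;
  by rewrite subUset !sub1set ?(negPf vS) ?(negPf wS) ?andbF.
Qed.

(* The hub is [0] and the leaves are [1], ..., [p.+2]; for odd [p] the last edge
   [p.+1 -- p.+2] shares a leaf with the edge [p -- p.+1]. *)
Definition windmill_leaf_edge (p i j : nat) : bool :=
  [&& 0 < i, j == i.+1 & odd i || (j == p.+2)].

Definition windmill_adj (p : nat) : rel 'I_p.+3 := fun i j =>
  [|| (i == 0 :> nat) && (0 < j), (j == 0 :> nat) && (0 < i),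
      windmill_leaf_edge p i j | windmill_leaf_edge p j i].

Lemma windmill_adj_sym (p : nat) : symmetric (windmill_adj p).
Proof. move=> i j; rewrite /windmill_adj /windmill_leaf_edge; lia. Qed.

Lemma windmill_adj_irrefl (p : nat) : irreflexive (windmill_adj p).
Proof. move=> i; rewrite /windmill_adj /windmill_leaf_edge; lia. Qed.

Definition windmill (p : nat) : sgraph :=
  @SGraph _ _ (windmill_adj_sym p) (windmill_adj_irrefl p).

Lemma windmill_connected (p : nat) : connected (windmill p).
Proof.
split; first by rewrite card_ord.
have hub (u : windmill p) : adj (ord0 : windmill p) u || (u == ord0).
  by rewrite -val_eqE /= /windmill_adj /=; lia.
have toHub (u : windmill p) : connect (@adj (windmill p)) u ord0.
  have /orP[a|/eqP->] := hub u; last exact: connect0.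
  by apply: connect1; rewrite adj_sym.
move=> u v; apply: connect_trans (toHub u) _.
by have /orP[/connect1|/eqP->] := hub v.
Qed.

Lemma windmill_triangle (p : nat) (i j : windmill p) :
  adj i j -> exists k : windmill p, adj i k && adj j k.
Proof.
(* [mate] sends a leaf to an adjacent leaf: [2i+1] and [2i+2] are paired, and an unpaired last leaf
   goes to its predecessor. *)
pose mate (l : nat) :=
  if odd l then (if l == p.+2 then p.+1 else l.+1) else l.-1.
(* A spoke is completed by the mate of its leaf, a leaf edge by the hub. *)
pose k := if i == 0 :> nat then mate j else if j == 0 :> nat then mate i else 0.
move=> ij; have ip := ltn_ord i; have jp := ltn_ord j.
have kE : (inord k : 'I_p.+3) = k :> nat.
  rewrite inordK //; move: ip jp; rewrite /k /mate.
  by do ![case: ifP]; lia.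
exists (inord k); move: ij ip jp.
by rewrite /= /windmill_adj /windmill_leaf_edge kE /k /mate; do ![case: ifP]; lia.
Qed.

Lemma windmill_star_dense (p : nat) : star_dense 3 (windmill p).
Proof.
split; first split.
- move=> u; have [-> |u0] := eqVneq u ord0.
    by exists ord_max.
  by exists ord0; move: u0; rewrite -val_eqE /= /windmill_adj /=; lia.
- move=> u v /windmill_triangle[k /andP[uk vk]].
  by apply/card_gt0P; exists k; rewrite !inE uk vk.
(* The spoke to leaf 1 refutes 4-density: its ends have no common neighbour other than leaf 2. *)
move=> [_ /(_ ord0 (inord 1))].
have adj01 : adj (ord0 : windmill p) (inord 1).
  by rewrite /= /windmill_adj /= inordK.
move=> /(_ adj01); apply/negP; rewrite -ltnNge ltnS.
apply: leq_trans (_ : #|[set (inord 2 : windmill p)]| <= 1); last by rewrite cards1.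
apply/subset_leq_card/subsetP => k.
rewrite !inE -val_eqE /= /windmill_adj /windmill_leaf_edge /= !inordK //; lia.
Qed.

Lemma windmill_edges_le (p : nat) : #|edges (windmill p)| <= p.+2 + uphalf p.+2.
Proof.
(* Leaf edge number [k] starts at [2k+1], capped at [p.+1] so that the extra edge for odd [p] is the
   last one. [f] lists [p.+2] spokes, then the leaf edges; covering all edges gives the bound. *)
pose leaf (k : nat) := minn k.*2.+1 p.+1.
pose f (x : 'I_p.+2 + 'I_(uphalf p.+2)) : {set windmill p} :=
  match x with
  | inl i => [set ord0; inord i.+1]
  | inr k => [set inord (leaf k); inord (leaf k).+1]
  end.
suff /subset_leq_card : edges (windmill p) \subset f @: setT.
  move/leq_trans; apply; apply: leq_trans (leq_imset_card _ _) _.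
  by rewrite cardsT card_sum !card_ord.
have hubE (j : windmill p) : 0 < j -> [set ord0; j] \in f @: setT.
  move=> j0; have jp : j.-1 < p.+2 by move: (ltn_ord j); lia.
  by apply/imsetP; exists (inl (Ordinal jp)); rewrite //= prednK // inord_val.
have leafE (i j : windmill p) :
    windmill_leaf_edge p i j -> [set i; j] \in f @: setT.
  move=> /and3P[i0 /eqP ji iodd]; have ip := ltn_ord i; have jp := ltn_ord j.
  have kp : i./2 < uphalf p.+2 by lia.
  apply/imsetP; exists (inr (Ordinal kp)) => //=.
  have -> : leaf i./2 = i by rewrite /leaf; lia.
  by rewrite -ji !inord_val.
apply/subsetP => e /imset2P[i j _]; rewrite inE => ij ->{e}.
case/or4P: ij => [/andP[/eqP i0 j0]|/andP[/eqP j0 i0]|/leafE//|/leafE].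
- by rewrite (_ : i = ord0) ?hubE //; apply: val_inj.
- by rewrite setUC (_ : j = ord0) ?hubE //; apply: val_inj.
- by rewrite setUC.
Qed.

(** Over the integers, [2m <= 3p + 1] is the strict bound [m - 1 < 3p/2]. *)
Lemma ceil_three_halves (p m : nat) :
  3 * p <= 2 * m <= 3 * p + 1 -> (m%:Z = Num.ceil (3%:Q / 2%:Q * p%:Q))%R.
Proof.
rewrite -!(Num.Theory.ler_nat rat) GRing.natrD !GRing.natrM => /andP[lo hi].
by apply/esym/Num.Theory.ceil_def; rewrite intrB -(pmulrn _ m) -(pmulrn _ p); lra.
Qed.

Local Open Scope ring_scope.

Theorem theorem4p3 (n : nat) (hn : (3 <= n)%N) :
  exists m : nat, min_edges 3 n m /\
    m%:Z = Num.ceil (3%:Q / 2%:Q * (n%:Q - 1)).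
Proof.
case: n hn => [|[|[|p]]] // _.
(* Here [n - 1] is [p.+2], and this sum is three halves of it, rounded up. *)
exists (p.+2 + uphalf p.+2)%N; split; last first.
  rewrite (_ : p.+3%:Q - 1 = p.+2%:Q); last by rewrite -[p.+3]addn1 PoszD intrD GRing.addrK.
  by apply: ceil_three_halves; lia.
have lower (G : sgraph) : #|G| = p.+3 -> connected G -> star_dense 3 G ->
    (p.+2 + uphalf p.+2 <= #|edges G|)%N.
  by move=> cG conn [d3 _]; have := connected_dense3_edges G conn d3; lia.
split; last by move=> G [cG conn sd]; exact: lower.
exists (windmill p); have cG : #|windmill p| = p.+3 by rewrite card_ord.
have conn := windmill_connected p; have sd := windmill_star_dense p.
(* The general lower bound, applied to the windmill itself, makes its edge count exact. *)
split=> //; apply/eqP; rewrite eqn_leq windmill_edges_le; exact: lower.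
Qed.
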